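(* Let $K$ be a compact hypergroup and let $\sigma$ be an adapted probability measure on $K$. Then $H_\sigma(K)=\mathbb{C}\omega$, where $\omega$ is the normalized Haar measure on $K$.
   Context: $K$ is a compact hypergroup (Jewett/Bloom–Heyer sense) with involution $x\mapsto\check x$, assumed to have a left Haar measure; the normalized Haar measure $\omega$ is the Haar measure of total mass one. For $\sigma\in M(K)$, $H_\sigma(K)=\{\mu\in M(K):\sigma*\mu=\mu\}$. For subsets $A,B\subseteq K$, $A*B=\bigcup_{a\in A,b\in B}\operatorname{supp}(\delta_a*\delta_b)$, $A^n$ is the $n$-fold product and $\check A=\{\check a:a\in A\}$. A measure $\mu\in M(K)$ is adapted if $K=\overline{\bigcup_{n\geq1}\left(\operatorname{supp}|\mu|\cup(\operatorname{supp}|\mu|)\check{}\right)^n}$. *)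

(* Defs.v *)
From HB Require Import structures.
From mathcomp Require Import all_boot all_order all_algebra.
From mathcomp Require Import all_classical all_reals all_analysis.
From mathcomp Require Import complex.

Set Implicit Arguments.
Unset Strict Implicit.
Unset Printing Implicit Defensive.

Import Order.TTheory GRing.Theory Num.Theory.
Import numFieldTopology.Exports numFieldNormedType.Exports.
Local Open Scope classical_set_scope.
Local Open Scope ring_scope.

(* Complex Radon measures on a compact Hausdorff space K are represented, as in
   Jewett/Bourbaki, by bounded linear functionals on C(K) = continuous K -> C,
   with C = R[i].  A "measure" is a map (K -> C) -> C; only its values on
   continuous functions matter (equality of measures = agreement on C(K)). *)

Section Hypergroup.
Variable R : realType.
Local Notation C := (R[i]).

Definition ccont {T : topologicalType} (f : T -> C) : Prop :=
  continuous (fun x => complex.Re (f x)) /\ continuous (fun x => complex.Im (f x)).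

Variable K : topologicalType.

Definition meas := (K -> C) -> C.

Definition is_cmeasure (mu : meas) : Prop :=
  (forall (a : C) (f g : K -> C), ccont f -> ccont g ->
      mu (fun x => a * f x + g x) = a * mu f + mu g) /\
  exists M : R, forall (f : K -> C) (c : R), ccont f ->
      (forall x, `|f x| <= (c%:C)%C) -> `|mu f| <= ((M * c)%:C)%C.

Definition is_positive (mu : meas) : Prop :=
  forall f : K -> C, ccont f -> (forall x, 0 <= f x) -> 0 <= mu f.

Definition is_probability (mu : meas) : Prop :=
  [/\ is_cmeasure mu, is_positive mu & mu (fun _ => 1) = 1].

Definition meq (mu nu : meas) : Prop := forall f : K -> C, ccont f -> mu f = nu f.

Definition dirac (x : K) : meas := fun f => f x.

(* support of a measure (= supp |mu|): x is in the support iff every open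
   neighbourhood U of x carries a continuous f vanishing off U with mu f <> 0 *)
Definition msupp (mu : meas) : set K :=
  [set x | forall U : set K, open U -> U x ->
     exists f : K -> C, [/\ ccont f, (forall y, ~ U y -> f y = 0) & mu f != 0]].

(* conv x y = delta_x * delta_y ; convolution of measures is its bilinear extension
   (mu * nu)(f) = int int (delta_x * delta_y)(f) dnu(y) dmu(x) *)
Definition mconv (conv : K -> K -> meas) (mu nu : meas) : meas :=
  fun f => mu (fun x => nu (fun y => conv x y f)).

Definition mcheck (inv : K -> K) (mu : meas) : meas := fun f => mu (fun x => f (inv x)).

Record is_compact_hypergroup (conv : K -> K -> meas) (inv : K -> K) (e : K) : Prop := {
  hg_hausdorff : hausdorff_space K;
  hg_compact : compact [set: K];
  hg_prob : forall x y, is_probability (conv x y);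
  hg_weak_cont : forall f : K -> C, ccont f -> ccont (fun p : K * K => conv p.1 p.2 f);
  hg_assoc : forall x y z,
    meq (mconv conv (dirac x) (mconv conv (dirac y) (dirac z)))
        (mconv conv (mconv conv (dirac x) (dirac y)) (dirac z));
  (* continuity of (x,y) |-> supp(delta_x * delta_y) for the Michael (Vietoris) topology *)
  hg_supp_upper : forall U : set K, open U ->
    open [set p : K * K | msupp (conv p.1 p.2) `<=` U];
  hg_supp_lower : forall U : set K, open U ->
    open [set p : K * K | msupp (conv p.1 p.2) `&` U !=set0];
  hg_unit : forall x, meq (conv e x) (dirac x) /\ meq (conv x e) (dirac x);
  hg_inv_cont : continuous inv;
  hg_inv_invol : forall x, inv (inv x) = x;
  hg_inv_conv : forall x y, meq (mcheck inv (conv x y)) (conv (inv y) (inv x));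
  hg_e_supp : forall x y, msupp (conv x (inv y)) e <-> x = y
}.

Definition is_left_haar (conv : K -> K -> meas) (omega : meas) : Prop :=
  [/\ is_cmeasure omega, is_positive omega,
      exists f, ccont f /\ omega f != 0 &
      forall x, meq (mconv conv (dirac x) omega) omega].

Definition setconv (conv : K -> K -> meas) (A B : set K) : set K :=
  [set z | exists a b, [/\ A a, B b & msupp (conv a b) z]].

(* setpow A n = A^(n+1) *)
Fixpoint setpow (conv : K -> K -> meas) (A : set K) (n : nat) : set K :=
  match n with
  | 0 => A
  | n'.+1 => setconv conv (setpow conv A n') A
  end.

Definition adapted (conv : K -> K -> meas) (inv : K -> K) (sigma : meas) : Prop :=
  closure [set z | exists n, setpow conv (msupp sigma `|` inv @` msupp sigma) n z]
  = [set: K].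

Definition in_Hsigma (conv : K -> K -> meas) (sigma mu : meas) : Prop :=
  is_cmeasure mu /\ meq (mconv conv sigma mu) mu.

End Hypergroup.

(* Main.v *)
(* For [f] continuous and [mu] with [sigma * mu = mu], the function
   [F x = (delta_x * mu)(f)] is continuous and satisfies
   [F x = \int (delta_x * delta_y)(F) dsigma(y)].  Expanding the square and using the
   right invariance of [omega],
   [\int \int (delta_x * delta_y)((F - F x)^2) dsigma(y) domega(x) = 0];
   as [omega] has full support, [F] is constant on [supp (delta_x * delta_y)] for all
   [x] and all [y] in [supp sigma].  The reciprocity
   [z \in supp (delta_x * delta_(inv y)) -> x \in supp (delta_z * delta_y)] extends this
   to [y] in [inv (supp sigma)], so adaptedness makes [F] constant.  Hence [mu] is left
   invariant, and Fubini's theorem identifies it with [mu(1) omega].  Fubini's theorem for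
   functionals on [C(K)] is obtained from partitions of unity.  A complex measure is
   handled through the real functionals given by its real and imaginary parts. *)

Require Import Defs.
From HB Require Import structures.
From mathcomp Require Import all_boot all_order all_algebra.
From mathcomp Require Import all_classical all_reals all_analysis.
From mathcomp Require Import complex.
From mathcomp Require Import ring lra.
Set Implicit Arguments.
Unset Strict Implicit.
Unset Printing Implicit Defensive.
Import Order.TTheory GRing.Theory Num.Theory.
Import numFieldTopology.Exports numFieldNormedType.Exports.
Local Open Scope classical_set_scope.
Local Open Scope ring_scope.

(** * Continuous real functions and sections of functions on products *)

Section ContinuousFunctions.
Variables (R : realType) (T : topologicalType).
Implicit Types f g : T -> R.

Lemma continuous_add f g : continuous f -> continuous g ->
  continuous (fun x => f x + g x).
Proof. by move=> cf cg x; apply: cvgD; [exact: cf|exact: cg]. Qed.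

Lemma continuous_sub f g : continuous f -> continuous g ->
  continuous (fun x => f x - g x).
Proof. by move=> cf cg x; apply: cvgB; [exact: cf|exact: cg]. Qed.

Lemma continuous_opp f : continuous f -> continuous (fun x => - f x).
Proof. by move=> cf x; apply: cvgN; exact: cf. Qed.

Lemma continuous_mul f g : continuous f -> continuous g ->
  continuous (fun x => f x * g x).
Proof. by move=> cf cg x; apply: cvgM; [exact: cf|exact: cg]. Qed.

Lemma continuous_sqr f : continuous f -> continuous (fun x => f x ^+ 2).
Proof. by move=> cf; exact: continuous_mul. Qed.

Lemma continuous_cst (a : R) : continuous (fun _ : T => a).
Proof. by move=> x; exact: cvg_cst. Qed.

Lemma continuous_inv f : (forall x, f x != 0) -> continuous f ->
  continuous (fun x => (f x)^-1).
Proof. by move=> f0 cf x; apply: cvgV; [exact: f0|exact: cf]. Qed.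

Lemma continuous_sum (I : Type) (s : seq I) (F : I -> T -> R) :
  (forall i, continuous (F i)) -> continuous (fun x => \sum_(i <- s) F i x).
Proof.
move=> cF; elim: s => [|i s IH].
  by under eq_fun do rewrite big_nil; exact: continuous_cst.
by under eq_fun do rewrite big_cons; exact: continuous_add.
Qed.

Lemma open_lt_fun f (a : R) : continuous f -> open [set x | f x < a].
Proof. by move=> cf; apply: (@open_comp _ _ f [set y | y < a]) => //; exact: open_lt. Qed.

Lemma open_gt_fun f (a : R) : continuous f -> open [set x | a < f x].
Proof. by move=> cf; apply: (@open_comp _ _ f [set y | a < y]) => //; exact: open_gt. Qed.

End ContinuousFunctions.

#[local] Hint Resolve continuous_add continuous_sub continuous_opp continuous_mul
  continuous_sqr continuous_cst continuous_sum : core.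

Lemma continuous_pairr (T U V : topologicalType) (g : T * U -> V) (x : T) :
  continuous g -> continuous (fun y => g (x, y)).
Proof.
move=> cg y; apply: (cvg_comp (fun y => (x, y)) g); last exact: cg.
by apply: cvg_pair => /=; [exact: cvg_cst|exact: cvg_id].
Qed.

Lemma continuous_pairl (T U V : topologicalType) (g : T * U -> V) (y : U) :
  continuous g -> continuous (fun x => g (x, y)).
Proof.
move=> cg x; apply: (cvg_comp (fun x => (x, y)) g); last exact: cg.
by apply: cvg_pair => /=; [exact: cvg_id|exact: cvg_cst].
Qed.

Lemma continuous_swap (T U V : topologicalType) (g : T * U -> V) :
  continuous g -> continuous (fun p : U * T => g (p.2, p.1)).
Proof.
move=> cg p; apply: (cvg_comp (fun p : U * T => (p.2, p.1)) g); last exact: cg.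
by apply: cvg_pair => /=; [exact: cvg_snd|exact: cvg_fst].
Qed.

Lemma open_sub_seq (T : topologicalType) (I : eqType) (U : I -> set T) (e : T)
    (s : seq I) :
  (forall i, open (U i) /\ U i e) ->
  exists V, [/\ open V, V e & forall i, i \in s -> V `<=` U i].
Proof.
move=> oU; elim: s => [|i s [V [oV Ve VU]]].
  by exists setT; split => //; exact: openT.
have [oi ie] := oU i; exists (U i `&` V); split; [exact: openI|by []|].
move=> j; rewrite inE => /orP[/eqP ->|/VU VUj]; first exact: subIsetl.
exact: subset_trans VUj.
Qed.

(** * Compact Hausdorff spaces: bump functions, partitions of unity, uniform continuity of
    sections *)

Section CompactSpace.
Variables (R : realType) (K : topologicalType).
Hypotheses (hausK : hausdorff_space K) (cptK : compact [set: K]).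

Lemma continuous_bounded (f : K -> R) : continuous f ->
  exists2 B, 0 < B & forall x, `|f x| <= B.
Proof.
move=> cf; have [M [_ MP]] : bounded_set (f @` setT).
  by apply/compact_bounded/continuous_compact => //; exact: continuous_subspaceT.
exists (`|M| + 1) => [|x]; first by rewrite ltr_pwDr.
by apply: MP; [rewrite ltr_pwDr// ler_norm|exists x].
Qed.

Lemma bump_fun (U : set K) (p : K) : open U -> U p ->
  exists psi : K -> R,
    [/\ continuous psi, forall x, 0 <= psi x, psi p = 1 & forall x, ~ U x -> psi x = 0].
Proof.
move=> oU Up; have cr : completely_regular_space K.
  apply: (@normal_completely_regular R); first exact: compact_normal.
  exact: hausdorff_accessible.
have us : uniform_separator [set p] (~` U) by apply: cr => //; exact: open_closedC.
have cu := @Urysohn_continuous K R [set p] (~` U).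
exists (fun x => 1 - Urysohn [set p] (~` U) x); split.
- exact: continuous_sub.
- move=> x; rewrite subr_ge0; have : `[0, 1]%classic (@Urysohn K R [set p] (~` U) x).
    by apply: Urysohn_range; exists x.
  by rewrite /= in_itv/= => /andP[].
- have -> : Urysohn [set p] (~` U) p = 0 :> R by apply: (Urysohn_sub0 us); exists p.
  by rewrite subr0.
- move=> x Ux.
  have -> : Urysohn [set p] (~` U) x = 1 :> R by apply: (Urysohn_sub1 us); exists x.
  by rewrite subrr.
Qed.

(* [compact_cover] assumes a pointed space; the near-covering form of compactness,
   applied to the filter of large finite lists, does not. *)
Lemma finite_subcover (U : K -> set K) : (forall p, open (U p) /\ U p p) ->
  exists s : seq K, forall x, exists2 p, p \in s & U p x.
Proof.
move=> oU; have /compact_near_coveringP cov := cptK.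
pose F : set_system (seq K) := [set P : set (seq K) |
    exists s : seq K, forall s' : seq K, {subset s <= s'} -> P s'].
have FF : Filter F.
  split; first by exists [::].
    move=> P Q [s sP] [t tQ]; exists (s ++ t) => u su.
    by split; [apply: sP|apply: tQ] => x xs; apply: su; rewrite mem_cat xs ?orbT.
  by move=> P Q PQ [s sP]; exists s => u su; apply/PQ/sP.
have [|s] := cov _ F (fun s x => exists2 p, p \in s & U p x) FF.
  move=> x _; have [oUx Uxx] := oU x.
  exists (U x, [set s : seq K | x \in s]).
    split; first exact: open_nbhs_nbhs.
    by exists [:: x] => s' /(_ x); rewrite inE eqxx; apply.
  by move=> [y s] /= [Uy xs]; exists x.
by move=> /(_ s (fun _ => id)) H; exists s => x; exact: H.
Qed.

Lemma partition_of_unity (U : K -> set K) :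
  (forall p, open (U p) /\ U p p) ->
  exists (s : seq K) (phi : K -> K -> R),
    [/\ forall p, continuous (phi p), forall p x, 0 <= phi p x,
        forall p x, ~ U p x -> phi p x = 0 & forall x, \sum_(p <- s) phi p x = 1].
Proof.
move=> oU; have /choice[psi psiP] : forall p, exists psi : K -> R,
    [/\ continuous psi, forall x, 0 <= psi x, psi p = 1 &
        forall x, ~ U p x -> psi x = 0].
  by move=> p; have [? ?] := oU p; exact: bump_fun.
have psic p : continuous (psi p) by case: (psiP p).
have psi0 p x : 0 <= psi p x by case: (psiP p).
have [|D Dcov] := @finite_subcover (fun p => [set x | 0 < psi p x]).
  by move=> p; split; [exact: open_gt_fun|case: (psiP p) => _ _ /= -> _].
pose S x := \sum_(p <- D) psi p x.
have S0 x : 0 < S x.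
  have [p /= pD px] := Dcov x.
  rewrite /S (big_rem p)//= ltr_pwDl// sumr_ge0// => q _; exact: psi0.
exists D, (fun p x => psi p x * (S x)^-1); split.
- move=> p; apply: continuous_mul => //; apply: continuous_inv; last exact: continuous_sum.
  by move=> x; rewrite gt_eqF.
- by move=> p x; rewrite mulr_ge0// invr_ge0 ltW.
- by move=> p x Ux; case: (psiP p) => _ _ _ ->//; rewrite mul0r.
- by move=> x; rewrite -big_distrl/= -/(S x) divff // gt_eqF.
Qed.

(** A tube argument: near each [(x0, y0)] both values are within [eps / 2] of [g (x0, y0)], and
    compactness in [y] yields one neighbourhood of [x0] valid for all [y]. *)
Lemma uniform_section (g : K * K -> R) (x0 : K) (eps : R) :
  continuous g -> 0 < eps ->
  \forall x \near x0, forall y, `|g (x, y) - g (x0, y)| <= eps.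
Proof.
move=> cg e0; have /compact_near_coveringP cov := cptK.
suff : \forall x \near x0, [set: K] `<=` (fun y => `|g (x, y) - g (x0, y)| <= eps).
  by apply: filterS => x Hx y; exact: Hx.
apply: cov => y0 _.
have e2 : 0 < eps / 2 by rewrite divr_gt0.
have /= Hg := cg (x0, y0); move/cvgrPdist_le/(_ _ e2) : Hg => [[A B] [/= nA nB] AB].
exists (B, A) => //= -[y x] /= [By Ax].
have H1 := AB (x, y) (conj Ax By); have H2 := AB (x0, y) (conj (nbhs_singleton nA) By).
rewrite /= in H1 H2; rewrite distrC in H1.
rewrite (_ : g (x, y) - g (x0, y) = (g (x, y) - g (x0, y0)) + (g (x0, y0) - g (x0, y))); last by ring.
by rewrite (le_trans (ler_normD _ _))// [leRHS](splitr eps) lerD.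
Qed.

End CompactSpace.

(** * Linear functionals on real continuous functions: support, positivity, Fubini *)

Section Functionals.
Variables (R : realType) (K : topologicalType).
Hypotheses (hausK : hausdorff_space K) (cptK : compact [set: K]).
Implicit Types (mu nu L : (K -> R) -> R) (f g h k : K -> R).

Definition linear_on_cont mu := forall a f g, continuous f -> continuous g ->
  mu (fun x => a * f x + g x) = a * mu f + mu g.

Definition bounded_functional mu := linear_on_cont mu /\
  exists M, forall f c, continuous f -> (forall x, `|f x| <= c) -> `|mu f| <= M * c.

Definition prob_functional mu :=
  [/\ linear_on_cont mu, forall f, continuous f -> (forall x, 0 <= f x) -> 0 <= mu f
    & mu (fun _ => 1) = 1].

Definition fsupp mu : set K := [set x | forall U, open U -> U x ->
  exists f, [/\ continuous f, forall y, ~ U y -> f y = 0 & mu f != 0]].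

Section Linear.
Variables (mu : (K -> R) -> R) (lmu : linear_on_cont mu).

Lemma functional0 : mu (fun _ => 0) = 0.
Proof.
have := lmu 1 (@continuous_cst R K 0) (@continuous_cst R K 0).
rewrite (_ : (fun _ => _) = (fun _ : K => 0)); last by apply/funext => x; rewrite mul1r addr0.
by rewrite mul1r => /eqP; rewrite -subr_eq0 opprD addNKr oppr_eq0 => /eqP.
Qed.

Lemma functionalZ a f : continuous f -> mu (fun x => a * f x) = a * mu f.
Proof.
move=> cf; have := lmu a cf (@continuous_cst R K 0).
by under eq_fun do rewrite addr0; rewrite functional0 addr0.
Qed.

Lemma functionalD f g : continuous f -> continuous g ->
  mu (fun x => f x + g x) = mu f + mu g.
Proof.
move=> cf cg; have := lmu 1 cf cg.
by under eq_fun do rewrite mul1r; rewrite mul1r.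
Qed.

Lemma functionalB f g : continuous f -> continuous g ->
  mu (fun x => f x - g x) = mu f - mu g.
Proof.
move=> cf cg; have := lmu (-1) cg cf.
by under eq_fun do rewrite mulN1r addrC; rewrite mulN1r addrC.
Qed.

Lemma functional_sum (I : Type) (s : seq I) (F : I -> K -> R) :
  (forall i, continuous (F i)) ->
  mu (fun x => \sum_(i <- s) F i x) = \sum_(i <- s) mu (F i).
Proof.
move=> cF; elim: s => [|i s IH].
  by under eq_fun do rewrite big_nil; rewrite big_nil functional0.
under eq_fun do rewrite big_cons; rewrite big_cons functionalD ?IH//.
exact: continuous_sum.
Qed.

Lemma functional_cst a : mu (fun _ => a) = a * mu (fun _ => 1).
Proof. by rewrite -functionalZ//; congr mu; apply/funext => x; rewrite mulr1. Qed.

(* A partition of unity localizes the vanishing of [mu h]. *)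
Lemma functional_eq0_local h : continuous h ->
  (forall p, exists U, [/\ open U, U p &
    forall psi, continuous psi -> (forall x, ~ U x -> psi x = 0) ->
      mu (fun x => h x * psi x) = 0]) ->
  mu h = 0.
Proof.
move=> ch /choice[U UP].
have [|s [phi [cphi _ phiU phi1]]] := @partition_of_unity R K hausK cptK U.
  by move=> p; case: (UP p).
have -> : h = (fun x => \sum_(p <- s) h x * phi p x).
  by apply/funext => x; rewrite -big_distrr/= phi1 mulr1.
rewrite functional_sum => [|p]; last exact: continuous_mul.
by apply: big1 => p _; case: (UP p) => _ _; apply => // x; exact: phiU.
Qed.

Lemma nfsuppP p : ~ fsupp mu p -> exists U, [/\ open U, U p &
  forall f, continuous f -> (forall x, ~ U x -> f x = 0) -> mu f = 0].
Proof.
move=> np; apply: contrapT => H; apply: np => U oU Up; apply: contrapT => H2.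
apply: H; exists U; split => // f cf fU; apply: contrapT => /eqP mf.
by apply: H2; exists f.
Qed.

(** Localize: near a point of [W] the function [h] vanishes, and at a point outside [W], hence off
    the support, [mu] kills everything supported in a small neighbourhood. *)
Lemma functional_eq0_off_supp (W : set K) h : open W -> fsupp mu `<=` W ->
  continuous h -> (forall x, W x -> h x = 0) -> mu h = 0.
Proof.
move=> oW sW ch hW; apply: functional_eq0_local => // p.
have [Wp|nWp] := pselect (W p).
  exists W; split => // psi cpsi psiW.
  rewrite (_ : (fun x => _) = (fun _ => 0)) ?functional0//; apply/funext => x.
  by have [/hW ->|/psiW ->] := pselect (W x); rewrite ?mul0r ?mulr0.
have [|U [oU Up UP]] := @nfsuppP p; first by move/sW.
exists U; split => // psi cpsi psiU; apply: UP => [|x /psiU ->]; last by rewrite mulr0.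
exact: continuous_mul.
Qed.

Lemma nfsupp_open : open (~` fsupp mu).
Proof.
rewrite openE => p /nfsuppP[U [oU Up UP]]; rewrite /interior nbhsE; exists U => // q Uq.
by move=> /(_ U oU Uq)[f [cf fU]]; rewrite UP ?eqxx.
Qed.

End Linear.

Lemma prob_bounded mu : prob_functional mu -> bounded_functional mu.
Proof.
move=> [lmu pmu mu1]; split => //; exists 1 => f c cf fc; rewrite mul1r ler_norml.
have H1 : 0 <= mu (fun x => c - f x).
  by apply: pmu => [|x]; [exact: continuous_sub|rewrite subr_ge0 (le_trans (ler_norm _))].
have H2 : 0 <= mu (fun x => c + f x).
  apply: pmu => [|x]; first exact: continuous_add.
  by rewrite -[f x]opprK subr_ge0 (le_trans (ler_norm _))// normrN.
move: H1 H2; rewrite functionalB// functionalD// functional_cst// mu1 mulr1.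
by move=> H1 H2; apply/andP; split; lra.
Qed.

Lemma prob_le mu f g : prob_functional mu -> continuous f -> continuous g ->
  (forall x, f x <= g x) -> mu f <= mu g.
Proof.
move=> [lmu pmu _] cf cg fg; rewrite -subr_ge0 -functionalB//.
by apply: pmu => [|x]; [exact: continuous_sub|rewrite subr_ge0].
Qed.

(** If [mu h = 0], a test function [f] vanishing off the set where [h > h p / 2] is dominated by a
    multiple of [h], so [mu f] and [mu (- f)] are both at most 0, against [mu f != 0]. *)
Lemma prob_gt0 mu h p : prob_functional mu -> fsupp mu p -> continuous h ->
  (forall x, 0 <= h x) -> 0 < h p -> 0 < mu h.
Proof.
move=> pmu sp ch h0 hp; have [lmu mu0 _] := pmu.
have hp2 : 0 < h p / 2 by rewrite divr_gt0.
have [|f [cf fU mf]] := sp _ (@open_gt_fun R K h (h p / 2) ch).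
  by rewrite /= ltr_pdivrMr// ltr_pMr// ltr1n.
have [B B0 fB] := continuous_bounded cptK cf.
rewrite lt_neqAle mu0// andbT; apply/eqP => muh.
have key g : continuous g -> (forall x, g x <= `|f x|) -> mu g <= 0.
  move=> cg gf; have -> : 0 = mu (fun x => (B / (h p / 2)) * h x).
    by rewrite functionalZ// -muh mulr0.
  apply: prob_le => // [|x]; first by apply: continuous_mul.
  rewrite (le_trans (gf x))//; have [hx|hx] := ltrP (h p / 2) (h x).
    by rewrite (le_trans (fB x))// mulrAC ler_pdivlMr// ler_pM2l// ltW.
  rewrite fU ?normr0; last by move=> /=; rewrite ltNge hx.
  by rewrite mulr_ge0// divr_ge0// ltW.
move/negP: mf; apply; rewrite eq_le key => [|//|x]; last exact: ler_norm.
rewrite -oppr_le0; have <- : mu (fun x => - f x) = - mu f.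
  by have := functionalB lmu (@continuous_cst R K 0) cf;
    under eq_fun do rewrite sub0r; rewrite functional0// sub0r.
by apply: key => [|x]; [exact: continuous_opp|rewrite -normrN ler_norm].
Qed.

Lemma prob_eq0_supp mu h p : prob_functional mu -> fsupp mu p -> continuous h ->
  (forall x, 0 <= h x) -> mu h = 0 -> h p = 0.
Proof.
move=> pmu sp ch h0 mh; apply/eqP; apply: contraT => hp.
have : 0 < mu h by apply: (@prob_gt0 _ _ p) => //; rewrite lt_neqAle eq_sym hp h0.
by rewrite mh ltxx.
Qed.

(** The constant [|M| + 1] is positive, so that later estimates can divide by it; the point [x0]
    ensures [0 <= c]. *)
Lemma bounded_functional_dist (x0 : K) mu : bounded_functional mu ->
  exists2 M, 0 < M & forall f g c, continuous f -> continuous g ->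
    (forall x, `|f x - g x| <= c) -> `|mu f - mu g| <= M * c.
Proof.
move=> [lmu [M MP]].
exists (`|M| + 1) => [|f g c cf cg fg]; first by rewrite ltr_pwDr.
have c0 : 0 <= c by rewrite (le_trans _ (fg x0)).
rewrite -functionalB// (le_trans (MP _ c _ fg))//; first exact: continuous_sub.
by rewrite ler_wpM2r// (le_trans (ler_norm _))// lerDl.
Qed.

Lemma continuous_param mu (g : K * K -> R) : bounded_functional mu -> continuous g ->
  continuous (fun x => mu (fun y => g (x, y))).
Proof.
move=> bmu cg x0; have [M M0 MP] := bounded_functional_dist x0 bmu.
apply/cvgrPdist_le => /= eps e0; have eM : 0 < eps / M by rewrite divr_gt0.
apply: filterS (uniform_section cptK x0 cg eM) => x Hx.
rewrite distrC (le_trans (MP _ _ _ _ _ Hx)) //; first exact: continuous_pairr.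
  exact: continuous_pairr.
by rewrite mulrCA divff ?mulr1// gt_eqF.
Qed.

(** By a partition of unity in the first variable, [g] is uniformly close to a finite sum of
    products, for which the exchange is mere linearity; boundedness of both functionals controls the
    error. *)
Lemma functional_fubini mu nu (g : K * K -> R) :
  bounded_functional mu -> bounded_functional nu -> continuous g ->
  mu (fun x => nu (fun y => g (x, y))) = nu (fun y => mu (fun x => g (x, y))).
Proof.
move=> bmu bnu cg; have [[x0 _]|K0] := pselect (exists x : K, True); last first.
  have f0 (f : K -> R) : f = fun _ => 0 by apply/funext => x; case: K0; exists x.
  by rewrite [X in mu X]f0 [X in nu X]f0 !functional0//; [case: bnu|case: bmu].
have [M M0 MP] := bounded_functional_dist x0 bmu.
have [N N0 NP] := bounded_functional_dist x0 bnu.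
have [lmu _] := bmu; have [lnu _] := bnu.
apply/eqP; rewrite -subr_eq0 -normr_le0; apply/ler_addgt0Pl => eps eps0; rewrite addr0.
(* Each of the two replacements of [g] by [g'] costs [M * N * d = eps / 2]. *)
pose d := eps / (2 * M * N).
have d0 : 0 < d by rewrite !(divr_gt0, mulr_gt0).
have /choice[U UP] : forall p, exists U, (open U /\ U p) /\
    forall x, U x -> forall y, `|g (x, y) - g (p, y)| <= d.
  move=> p; have := uniform_section cptK p cg d0; rewrite /prop_near1 nbhsE => -[U [oU Up] UP].
  by exists U.
have [|s [phi [cphi phi0 phiU phi1]]] := @partition_of_unity R K hausK cptK U.
  by move=> p; case: (UP p).
pose g' (z : K * K) := \sum_(p <- s) phi p z.1 * g (p, z.2).
have cgp p : continuous (fun y => g (p, y)) by exact: continuous_pairr.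
have cg'r x : continuous (fun y => g' (x, y)).
  by rewrite /g'/=; apply: continuous_sum => p; apply: continuous_mul.
have cg'l y : continuous (fun x => g' (x, y)).
  by rewrite /g'/=; apply: continuous_sum => p; apply: continuous_mul.
have gg' x y : `|g (x, y) - g' (x, y)| <= d.
  rewrite /g'/= -[g (x, y)]mul1r -(phi1 x) big_distrl/= -sumrB.
  rewrite (le_trans (ler_norm_sum _ _ _))// -[d]mul1r -(phi1 x) big_distrl/=.
  apply: ler_sum => p _; rewrite -mulrBr normrM ger0_norm//.
  have [/(proj2 (UP p)) H|/phiU ->] := pselect (U p x); last by rewrite !mul0r.
  by rewrite ler_wpM2l.
have numu x : nu (fun y => g' (x, y)) = \sum_(p <- s) nu (fun y => g (p, y)) * phi p x.
  rewrite /g'/= functional_sum//; last by move=> p; apply: continuous_mul.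
  by apply: eq_bigr => p _; rewrite functionalZ// mulrC.
have mup y : mu (fun x => g' (x, y)) = \sum_(p <- s) mu (phi p) * g (p, y).
  rewrite /g'/= functional_sum//; last by move=> p; apply: continuous_mul.
  apply: eq_bigr => p _; rewrite mulrC -functionalZ//.
  by congr mu; apply/funext => x; rewrite mulrC.
have cnu : continuous (fun x => nu (fun y => g' (x, y))).
  under eq_fun do rewrite numu.
  by apply: continuous_sum => p; apply: continuous_mul.
have cmu : continuous (fun y => mu (fun x => g' (x, y))).
  under eq_fun do rewrite mup.
  by apply: continuous_sum => p; apply: continuous_mul.
have E : mu (fun x => nu (fun y => g' (x, y))) = nu (fun y => mu (fun x => g' (x, y))).
  under eq_fun do rewrite numu.
  under [in RHS]eq_fun do rewrite mup.
  rewrite !functional_sum//; [|by move=> p; apply: continuous_mul..].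
  by apply: eq_bigr => p _; rewrite !functionalZ// mulrC.
have H1 : `|mu (fun x => nu (fun y => g (x, y))) - mu (fun x => nu (fun y => g' (x, y)))|
    <= M * (N * d).
  apply: MP => // [|x]; first exact: (continuous_param bnu cg).
  by apply: NP => //; exact: cgp.
have H2 : `|nu (fun y => mu (fun x => g' (x, y))) - nu (fun y => mu (fun x => g (x, y)))|
    <= N * (M * d).
  apply: NP => // [|y]; first exact: (continuous_param bmu (continuous_swap cg)).
  have cl : continuous (fun x => g (x, y)) by exact: (@continuous_pairl _ _ _ g y cg).
  apply: MP; [exact: cg'l|exact: cl|].
  by move=> x; rewrite distrC.
rewrite -(subrKA (mu (fun x => nu (fun y => g' (x, y))))) {2}E.
rewrite (le_trans (ler_normD _ _))// (le_trans (lerD H1 H2))//.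
rewrite /d le_eqVlt; apply/orP; left; apply/eqP; field.
by rewrite !gt_eqF.
Qed.

End Functionals.

(** * Convolution on real test functions: supports under involution and rotation *)

Section RealHypergroup.
Variables (R : realType) (K : topologicalType).
Hypotheses (hausK : hausdorff_space K) (cptK : compact [set: K]).
Variables (c : K -> K -> (K -> R) -> R) (inv : K -> K) (e : K).
Hypothesis c_prob : forall x y, prob_functional (c x y).
Hypothesis c_cont : forall f : K -> R, continuous f -> continuous (fun p : K * K => c p.1 p.2 f).
Hypothesis c_assoc : forall x y z (f : K -> R), continuous f ->
  c y z (fun v => c x v f) = c x y (fun w => c w z f).
Hypothesis c_supp_upper : forall U : set K, open U ->
  open [set p : K * K | fsupp (c p.1 p.2) `<=` U].
Hypothesis c_e_l : forall x (f : K -> R), continuous f -> c e x f = f x.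
Hypothesis c_e_r : forall x (f : K -> R), continuous f -> c x e f = f x.
Hypothesis inv_cont : continuous inv.
Hypothesis invK : involutive inv.
Hypothesis c_inv : forall x y (f : K -> R), continuous f ->
  c x y (fun z => f (inv z)) = c (inv y) (inv x) f.
Hypothesis e_suppE : forall x y, fsupp (c x (inv y)) e <-> x = y.

Implicit Types (f g h : K -> R) (mu nu : (K -> R) -> R).

Let c_lin x y : linear_on_cont (c x y). Proof. by case: (c_prob x y). Qed.
Let c_bnd x y : bounded_functional (c x y). Proof. exact: prob_bounded. Qed.
Let c_ge0 x y f : continuous f -> (forall x, 0 <= f x) -> 0 <= c x y f.
Proof. by case: (c_prob x y) => _ H _; exact: H. Qed.

Let c_contr x f : continuous f -> continuous (fun y => c x y f).
Proof. by move=> /c_cont cf; exact: (@continuous_pairr _ _ _ _ x cf). Qed.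

Let c_contl y f : continuous f -> continuous (fun x => c x y f).
Proof. by move=> /c_cont cf; exact: (@continuous_pairl _ _ _ _ y cf). Qed.

Let inv_contf f : continuous f -> continuous (fun x => f (inv x)).
Proof. by move=> cf x; apply: (cvg_comp inv f); [exact: inv_cont|exact: cf]. Qed.

Lemma conv_param_cont mu f : bounded_functional mu -> continuous f ->
  continuous (fun x => mu (fun y => c x y f)).
Proof. by move=> bmu /c_cont cf; exact: (continuous_param cptK bmu cf). Qed.

Lemma conv_fubini mu nu f : bounded_functional mu -> bounded_functional nu ->
  continuous f ->
  mu (fun x => nu (fun y => c x y f)) = nu (fun y => mu (fun x => c x y f)).
Proof. by move=> bmu bnu /c_cont cf; exact: (functional_fubini hausK cptK bmu bnu cf). Qed.

Lemma fsupp_inv x y z : fsupp (c x y) z -> fsupp (c (inv y) (inv x)) (inv z).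
Proof.
move=> sz U oU Uz; have [|f [cf fU mf]] := sz (inv @^-1` U) _ Uz.
  by apply: open_comp.
exists (fun x => f (inv x)); split; first exact: inv_contf.
  by move=> w Uw; apply: fU; rewrite /= invK.
by rewrite c_inv// !invK.
Qed.

(* Both bracketings of [inv a3 * a1 * a2] charge every neighbourhood of [e]; if
   [inv a2] were not in the support of [inv a3 * a1], a bump function at [e] with
   small enough support would be annihilated by the second one. *)
Lemma fsupp_rotate a1 a2 a3 :
  fsupp (c a1 a2) a3 -> fsupp (c (inv a3) a1) (inv a2).
Proof.
move=> s3; apply: contrapT => n2.
(* Around each [p], a neighbourhood [NU.1] of [p] and a neighbourhood [NU.2] of [e] such that the
   second bracketing, localized to [NU.1], kills functions supported in [NU.2]. *)
have /choice[NU NUP] : forall p, exists NU : set K * set K,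
   [/\ open NU.1 /\ NU.1 p, open NU.2 /\ NU.2 e &
     forall h psi, continuous h -> continuous psi ->
       (forall x, ~ NU.2 x -> h x = 0) -> (forall x, ~ NU.1 x -> psi x = 0) ->
       c (inv a3) a1 (fun w => c w a2 h * psi w) = 0].
  move=> p; have [sp|/nfsuppP[N [oN Np NP]]] := pselect (fsupp (c (inv a3) a1) p); last first.
    exists (N, setT); split => //=; first by split => //; exact: openT.
    move=> h psi ch cpsi _ psiN; apply: NP => [|x /psiN ->]; last by rewrite mulr0.
    by apply: continuous_mul => //; exact: c_contl.
  (* The support of [c p a2] contains [e] only if [p = inv a2], which [n2] excludes for [p] in the
     support of [c (inv a3) a1]. *)
  have ne : ~ fsupp (c p a2) e.
    by rewrite -{1}(invK a2) => /e_suppE pa; apply: n2; rewrite -pa.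
  have oS : open (~` fsupp (c p a2)) by exact: nfsupp_open.
  have [psi [cpsi psi0 psi1 psiS]] := bump_fun R hausK cptK oS ne.
  have oW := @open_lt_fun R K psi (1/2) cpsi.
  have oU := @open_gt_fun R K psi (1/2) cpsi.
  (* Upper semicontinuity keeps the support of [c w a2] inside [psi < 1/2] for [w] near [p], away
     from functions living where [psi > 1/2]. *)
  exists ([set w | fsupp (c w a2) `<=` [set x | psi x < 1/2]], [set x | 1/2 < psi x]).
  split => /=.
  - split; last by move=> x Sx /=; rewrite psiS ?divr_gt0// => /(_ Sx).
    have := c_supp_upper oW; rewrite !openE => H w Hw; have := H (w, a2) Hw.
    by move=> [[A B] [/= nA nB] AB]; apply: filterS nA => x Ax;
       exact: (AB (x, a2) (conj Ax (nbhs_singleton nB))).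
  - by split => //; rewrite psi1 ltr_pdivrMr// mul1r ltr1n.
  - move=> h phi ch cphi hU phiN; rewrite (_ : (fun w => _) = fun _ => 0).
      exact: functional0.
    apply/funext => w; have [sw|/phiN ->] := pselect (fsupp (c w a2) `<=` [set x | psi x < 1/2]);
      last by rewrite mulr0.
    rewrite (functional_eq0_off_supp hausK cptK (c_lin w a2) oW sw ch) ?mul0r//.
    by move=> x /= psix; apply: hU => /=; rewrite ltNge ltW.
have [|s [phi [cphi _ phiN phi1]]] := @partition_of_unity R K hausK cptK (fun p => (NU p).1).
  by move=> p; case: (NUP p).
have [|V [oV Ve VU]] := @open_sub_seq K K (fun p => (NU p).2) e s.
  by move=> p; case: (NUP p).
have [h [ch h0 h1 hV]] := bump_fun R hausK cptK oV Ve.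
(* The first bracketing is positive: [a3] is in the support of [c a1 a2], and [e] in that of
   [c (inv a3) a3]. *)
have : 0 < c a1 a2 (fun w => c (inv a3) w h).
  apply: (prob_gt0 cptK (c_prob a1 a2) s3) => [|x|]; first exact: c_contr.
    exact: c_ge0.
  apply: (@prob_gt0 R K cptK _ _ e) => //; last by rewrite h1.
  by rewrite -{2}(invK a3); apply/e_suppE.
rewrite c_assoc// (_ : (fun w => _) = (fun w => \sum_(p <- s) c w a2 h * phi p w)); last first.
  by apply/funext => w; rewrite -big_distrr/= phi1 mulr1.
rewrite functional_sum//; last by move=> p; apply: continuous_mul => //; exact: c_contl.
rewrite big_seq big1 ?ltxx// => p ps; case: (NUP p) => _ _; apply => //.
  by move=> x nx; apply: hV => /(VU p ps).
exact: phiN.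
Qed.

(** Two rotations put [inv x] in the support of [c (inv y) (inv z)]; the involution then reverses
    the product. *)
Lemma fsupp_recip x y z : fsupp (c x (inv y)) z -> fsupp (c z y) x.
Proof.
by move=> /fsupp_rotate/fsupp_rotate/fsupp_inv; rewrite !invK.
Qed.

(** * Normalized Haar functional: uniqueness, two-sided invariance, full support *)

Section Haar.
Variable omega : (K -> R) -> R.
Hypothesis omega_prob : prob_functional omega.
Hypothesis omega_inv : forall x f, continuous f -> omega (fun y => c x y f) = omega f.

Let omega_lin : linear_on_cont omega. Proof. by case: omega_prob. Qed.
Let omega_bnd : bounded_functional omega. Proof. exact: prob_bounded. Qed.

(** The image of [omega] under the involution; it is right invariant because [omega] is left
    invariant. *)
Let omega_check f := omega (fun x => f (inv x)).

Let omega_check_bnd : bounded_functional omega_check.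
Proof.
apply: prob_bounded; split.
- by move=> a f g cf cg; exact: (omega_lin a (inv_contf cf) (inv_contf cg)).
- by move=> f cf f0; case: omega_prob => _ H _; apply: H => [|x//]; exact: inv_contf.
- by case: omega_prob.
Qed.

(** Integrate [c x y f] against [omega_check] in [x] and [mu] in [y]. Left invariance of [mu]
    reduces this to [mu f]; after Fubini, right invariance of [omega_check] reduces it to the
    right-hand side. *)
Let left_invariant_omega_check mu f : bounded_functional mu ->
  (forall x f, continuous f -> mu (fun y => c x y f) = mu f) ->
  continuous f -> mu f = mu (fun _ => 1) * omega_check f.
Proof.
move=> bmu mu_inv cf; have [lmu _] := bmu.
transitivity (omega_check (fun x => mu (fun y => c x y f))).
  rewrite /omega_check; under eq_fun do rewrite mu_inv//.
  by rewrite functional_cst//; case: omega_prob => _ _ ->; rewrite mulr1.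
rewrite conv_fubini// [RHS]mulrC -functional_cst//; congr mu; apply/funext => y.
rewrite /omega_check -[RHS](@omega_inv (inv y) _ (inv_contf cf)).
by congr omega; apply/funext => x; rewrite c_inv// invK.
Qed.

Lemma haar_inv f : continuous f -> omega (fun x => f (inv x)) = omega f.
Proof.
move=> cf; rewrite [RHS]left_invariant_omega_check//.
by case: omega_prob => _ _ ->; rewrite mul1r.
Qed.

Lemma left_invariant_haar mu f : bounded_functional mu ->
  (forall x f, continuous f -> mu (fun y => c x y f) = mu f) ->
  continuous f -> mu f = mu (fun _ => 1) * omega f.
Proof. by move=> ? ? cf; rewrite left_invariant_omega_check// /omega_check haar_inv. Qed.

Lemma haar_right_inv y f : continuous f -> omega (fun x => c x y f) = omega f.
Proof.
move=> cf; rewrite -haar_inv; last exact: c_contl.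
rewrite -(haar_inv cf) -[RHS](@omega_inv (inv y) _ (inv_contf cf)).
by congr omega; apply/funext => x; rewrite c_inv// invK.
Qed.

(** If [h x0 > 0], finitely many translates of [h] add up to an everywhere positive [S]. Translation
    preserves the integral, so [omega S = 0], while a multiple of [S] dominates 1. *)
Lemma haar_eq0 h : continuous h -> (forall x, 0 <= h x) -> omega h = 0 ->
  forall x, h x = 0.
Proof.
move=> ch h0 oh x0; apply/eqP; apply: contraT => hx0; exfalso.
have {}hx0 : 0 < h x0 by rewrite lt_neqAle eq_sym hx0 h0.
(* The product of [x0], [inv x] and [x] charges [h], because [e] lies in the support of
   [c (inv x) x] and [c x0 e h = h x0]; after rebracketing, [c w x h] cannot vanish for all [w]. *)
have /choice[a aP] : forall x, exists a, 0 < c a x h.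
  move=> x; apply: contrapT => H.
  have : 0 < c (inv x) x (fun v => c x0 v h).
    apply: (@prob_gt0 R K cptK _ _ e) => //.
    + by rewrite -{2}(invK x); apply/e_suppE.
    + exact: c_contr.
    + by move=> y; exact: c_ge0.
    + by rewrite c_e_r.
  rewrite c_assoc// (_ : (fun w => _) = fun _ => 0) ?functional0 ?ltxx//.
  apply/funext => w; apply/eqP; rewrite eq_le c_ge0// andbT leNgt.
  by apply/negP => Hw; apply: H; exists w.
have [|s sP] := @finite_subcover K cptK (fun p => [set x | 0 < c (a p) x h]).
  by move=> p; split => //=; apply: open_gt_fun; exact: c_contr.
pose S x := \sum_(p <- s) c (a p) x h.
have cS : continuous S by apply: continuous_sum => p; exact: c_contr.
have S0 x : 0 < S x.
  have [p ps px] := sP x; rewrite /S (big_rem p)//= ltr_pwDl// sumr_ge0// => q _.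
  exact: c_ge0.
have oS : omega S = 0.
  rewrite /S functional_sum//; last by move=> p; exact: c_contr.
  by apply: big1 => p _; rewrite omega_inv.
have [B B0 SB] := continuous_bounded cptK (continuous_inv (fun x => lt0r_neq0 (S0 x)) cS).
have : omega (fun _ => 1) <= omega (fun x => B * S x).
  apply: prob_le => // [|x]; first exact: continuous_mul.
  by rewrite -ler_pdivrMr// div1r (le_trans (ler_norm _)).
by rewrite functionalZ// oS mulr0; case: omega_prob => _ _ ->; rewrite ler10.
Qed.

(** * Harmonic functions and adaptedness *)

Section Harmonic.
Variable sigma : (K -> R) -> R.
Hypothesis sigma_prob : prob_functional sigma.

Let sigma_lin : linear_on_cont sigma. Proof. by case: sigma_prob. Qed.
Let sigma_bnd : bounded_functional sigma. Proof. exact: prob_bounded. Qed.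

(* Integrating the variance-like quantity [sigma (fun y => c x y ((F - F x)^2))]
   against [omega] gives 0 by right invariance. *)
Lemma harmonic_const_on_supp F : continuous F ->
  (forall x, sigma (fun y => c x y F) = F x) ->
  forall x y z, fsupp sigma y -> fsupp (c x y) z -> F z = F x.
Proof.
move=> cF hF x y z sy sz.
have cF2 : continuous (fun x => F x ^+ 2) by exact: continuous_sqr.
have cd a : continuous (fun w => (F w - F a) ^+ 2).
  by apply: continuous_sqr; exact: continuous_sub.
have sq_exp a b : c a b (fun w => (F w - F a) ^+ 2) =
    c a b (fun w => F w ^+ 2) - 2 * F a * c a b F + F a ^+ 2.
  rewrite (_ : (fun w => _) = (fun w => F w ^+ 2 - 2 * F a * F w + F a ^+ 2)); last first.
    by apply/funext => w; ring.
  rewrite functionalD//; [|by apply: continuous_sub => //; exact: continuous_mul].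
  rewrite functionalB//; [|exact: continuous_mul].
  rewrite functionalZ// functional_cst//.
  by case: (c_prob a b) => _ _ ->; rewrite mulr1.
pose q a := sigma (fun b => c a b (fun w => (F w - F a) ^+ 2)).
(* Harmonicity turns the cross term into [- 2 * F a ^+ 2], which leaves this difference. *)
have qE : q = fun a => sigma (fun b => c a b (fun w => F w ^+ 2)) - F a ^+ 2.
  apply/funext => a; rewrite /q; under eq_fun do rewrite sq_exp.
  rewrite functionalD//; last first.
    apply: continuous_sub; first exact: c_contr.
    by apply: continuous_mul => //; exact: c_contr.
  rewrite functionalB//; [|exact: c_contr|by apply: continuous_mul => //; exact: c_contr].
  rewrite functionalZ//; last exact: c_contr.
  rewrite hF functional_cst//; case: sigma_prob => _ _ ->; ring.
have qcont : continuous q.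
  by rewrite qE; apply: continuous_sub => //; exact: conv_param_cont.
have q0 : forall a, q a = 0.
  apply: haar_eq0 => //.
    move=> a; case: sigma_prob => _ H _; apply: H.
      under eq_fun do rewrite sq_exp.
      apply: continuous_add => //; apply: continuous_sub; first exact: c_contr.
      by apply: continuous_mul => //; exact: c_contr.
    by move=> b; apply: c_ge0 => // w; exact: sqr_ge0.
  rewrite qE functionalB//; last exact: conv_param_cont.
  rewrite conv_fubini//; under eq_fun do rewrite haar_right_inv//.
  by rewrite functional_cst//; case: sigma_prob => _ _ ->; rewrite mulr1 subrr.
(* A nonnegative continuous function of integral 0 vanishes on the support: first for [sigma] at
   [y], then for [c x y] at [z]. *)
have cxy : c x y (fun w => (F w - F x) ^+ 2) = 0.
  apply: (@prob_eq0_supp R K cptK sigma (fun b => c x b (fun w => (F w - F x) ^+ 2)) y) => //.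
  - exact: c_contr.
  - by move=> b; apply: c_ge0 => // w; exact: sqr_ge0.
  - exact: q0.
have := @prob_eq0_supp R K cptK _ (fun w => (F w - F x) ^+ 2) z (c_prob x y) sz (cd x).
move=> /(_ (fun w => sqr_ge0 _) cxy) /eqP.
by rewrite sqrf_eq0 subr_eq0 => /eqP.
Qed.

(** Adaptedness as an induction principle on closed sets: such an [A] contains all powers of the
    symmetrized support of [sigma], hence their closure. *)
Hypothesis sigma_adapted : forall A : set K, closed A ->
  (forall y, fsupp sigma y -> A y) -> (forall y, fsupp sigma y -> A (inv y)) ->
  (forall x y z, A x -> fsupp sigma y \/ fsupp sigma (inv y) -> fsupp (c x y) z -> A z) ->
  forall x, A x.

Lemma harmonic_const F : continuous F ->
  (forall x, sigma (fun y => c x y F) = F x) -> forall x, F x = F e.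
Proof.
move=> cF hF; have step := harmonic_const_on_supp cF hF.
have step' x y z : fsupp sigma y \/ fsupp sigma (inv y) -> fsupp (c x y) z -> F z = F x.
  move=> [sy|sy sz]; first exact: step.
  (* When [inv y] is in the support, reciprocity lets the step run backwards, from [z] to [x]. *)
  by symmetry; apply: (step _ _ _ sy); apply: fsupp_recip; rewrite invK.
have e_supp y : fsupp (c e y) y.
  move=> U oU Uy; have [psi [cpsi _ psi1 psiU]] := bump_fun R hausK cptK oU Uy.
  by exists psi; split => //; rewrite c_e_l// psi1 oner_neq0.
(* The closed set is the level set [F x = F e]; its initial points are reached from [e], as [y] lies
   in the support of [c e y]. *)
apply: sigma_adapted.
- rewrite (_ : (fun x => _) = F @^-1` [set F e])//.
  apply: preimage_closed => //; exact: closed_eq.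
- by move=> y sy; apply: (step' _ y) => //; left.
- by move=> y sy; apply: (step' _ (inv y)) => //; right; rewrite invK.
- by move=> x y z <- ys zs; exact: (step' _ y).
Qed.

Theorem harmonic_functional_haar mu : bounded_functional mu ->
  (forall f, continuous f -> sigma (fun x => mu (fun y => c x y f)) = mu f) ->
  forall f, continuous f -> mu f = mu (fun _ => 1) * omega f.
Proof.
move=> bmu hmu; have [lmu _] := bmu => f0 cf0.
apply: left_invariant_haar => // x f cf {f0 cf0}.
have -> : mu f = mu (fun y => c e y f).
  by congr mu; apply/funext => y; rewrite c_e_l.
apply: (@harmonic_const (fun x => mu (fun y => c x y f))).
  exact: conv_param_cont.
(* Harmonicity at [x] is the hypothesis on [mu] for the left translate [fun v => c x v f], up to
   Fubini and associativity. *)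
move=> {}x; rewrite -[RHS]hmu; last exact: c_contr.
congr sigma; apply/funext => y; rewrite conv_fubini//.
by congr mu; apply/funext => v; rewrite c_assoc.
Qed.

End Harmonic.
End Haar.
End RealHypergroup.

(** * Complex measures as pairs of real functionals *)

Section ComplexMeasures.
Variables (R : realType) (K : topologicalType).
Local Open Scope complex_scope.
Implicit Types (mu : meas R K) (f g : K -> R).

(** Only real test functions are fed in, so both parts are linear over [R]; together they determine
    [mu] by complex linearity. *)
Definition re_meas mu f : R := complex.Re (mu (fun x => (f x)%:C)).
Definition im_meas mu f : R := complex.Im (mu (fun x => (f x)%:C)).

Lemma ccont_real f : continuous f -> ccont (fun x => (f x)%:C).
Proof. by move=> cf; split => //=; exact: continuous_cst. Qed.

Lemma norm_real_complex (a : R) : `|a%:C| = `|a|%:C.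
Proof. by rewrite normc_def /= expr0n addr0 sqrtr_sqr. Qed.

Lemma normc_ge_Im (z : R[i]) : `|complex.Im z|%:C <= `|z|.
Proof. by rewrite normc_def lecR -sqrtr_sqr ler_wsqrtr// lerDr sqr_ge0. Qed.

Lemma re_im_meas_bounded mu : is_cmeasure mu ->
  bounded_functional (re_meas mu) /\ bounded_functional (im_meas mu).
Proof.
move=> [lmu [M MP]].
have lin a f g : continuous f -> continuous g ->
    mu (fun x => (a * f x + g x)%:C) = a%:C * mu (fun x => (f x)%:C) + mu (fun x => (g x)%:C).
  move=> cf cg; rewrite -lmu; [|exact: ccont_real..].
  by congr mu; apply/funext => x; rewrite rmorphD rmorphM.
have bnd f c : continuous f -> (forall x, `|f x| <= c) ->
    `|mu (fun x => (f x)%:C)| <= (M * c)%:C.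
  move=> cf fc; apply: MP; first exact: ccont_real.
  by move=> x; rewrite norm_real_complex lecR.
split; split.
- move=> a f g cf cg; rewrite /re_meas lin//.
  by case: (mu _) => ? ?; case: (mu _) => ? ? /=; rewrite mul0r subr0.
- by exists M => f c cf fc; rewrite -lecR (le_trans (normc_ge_Re _))// bnd.
- move=> a f g cf cg; rewrite /im_meas lin//.
  by case: (mu _) => ? ?; case: (mu _) => ? ? /=; rewrite mul0r addr0.
- by exists M => f c cf fc; rewrite -lecR (le_trans (normc_ge_Im _))// bnd.
Qed.

Lemma meas_ReIm mu (f : K -> R[i]) : is_cmeasure mu -> ccont f ->
  mu f = 'i * mu (fun x => (complex.Im (f x))%:C) + mu (fun x => (complex.Re (f x))%:C).
Proof.
move=> [lmu _] [cr ci]; rewrite -lmu; [|exact: ccont_real..].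
by congr mu; apply/funext => x; rewrite {1}[f x]complexE addrC.
Qed.

Lemma cmeasure_cst mu (a : R[i]) : is_cmeasure mu ->
  mu (fun _ => a) = a * mu (fun _ => 1).
Proof.
move=> [lmu _]; have c1 (b : R) : ccont (fun _ : K => b%:C).
  by apply: ccont_real; exact: continuous_cst.
have E1 := lmu 1 _ _ (c1 0) (c1 0); have Ea := lmu a _ _ (c1 1) (c1 0).
have z : mu (fun _ => 0%:C) = 0.
  move: E1; rewrite (_ : (fun _ => _) = (fun _ : K => 0%:C)); last first.
    by apply/funext => x; rewrite mul1r addr0.
  by rewrite mul1r => /eqP; rewrite -subr_eq0 opprD addNKr oppr_eq0 => /eqP.
rewrite z in Ea; rewrite -[RHS]addr0 -[RHS]Ea; congr mu; apply/funext => x.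
by rewrite mulr1 addr0.
Qed.

Hypothesis cptK : compact [set: K].

(** For [B] bounding [|f|], [mu] of [B + f] is a nonnegative complex number, hence real, and [mu] of
    the constant [B] is real because [mu] has mass 1. *)
Lemma probability_real mu f : is_probability mu -> continuous f ->
  mu (fun x => (f x)%:C) = (re_meas mu f)%:C.
Proof.
move=> [cmu pmu mu1] cf; have [_ [lim _]] := re_im_meas_bounded cmu.
have [B B0 fB] := continuous_bounded cptK cf.
suff im0 : im_meas mu f = 0.
  by rewrite [LHS]complexE -/(im_meas mu f) im0 mulr0 addr0.
have : 0 <= mu (fun x => (B + f x)%:C).
  apply: pmu => [|x]; first by apply: ccont_real; exact: continuous_add.
  by rewrite ler0c -[f x]opprK subr_ge0 (le_trans (ler_norm _))// normrN.
move/ger0_Im; rewrite -/(im_meas mu (fun x => B + f x)) functionalD// functional_cst//.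
by rewrite {1}/im_meas mu1/= mulr0 add0r.
Qed.

Lemma probability_re mu : is_probability mu -> prob_functional (re_meas mu).
Proof.
move=> pm; have [cmu pmu mu1] := pm.
have [[lre _] _] := re_im_meas_bounded cmu; split => //.
- move=> f cf f0; rewrite -ler0c -probability_real//.
  by apply: pmu => [|x]; [exact: ccont_real|rewrite ler0c].
- by rewrite /re_meas mu1.
Qed.

(** If [mu f] is nonzero, so is the integral of the real or of the imaginary part of [f], and both
    parts vanish where [f] does. *)
Lemma msupp_re mu : is_probability mu -> msupp mu = fsupp (re_meas mu).
Proof.
move=> pm; have [cmu _ _] := pm; apply/seteqP; split => x sx U oU Ux.
  have [f [cf fU mf]] := sx U oU Ux.
  have [cr ci] := cf; move: mf; rewrite (meas_ReIm cmu cf) => mf.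
  have [r0|r0] := eqVneq (re_meas mu (fun x => complex.Re (f x))) 0; last first.
    by exists (fun x => complex.Re (f x)); split => // y /fU ->.
  exists (fun x => complex.Im (f x)); split => // [y /fU -> //|].
  apply: contra mf => /eqP i0.
  by rewrite !probability_real// r0 i0 mulr0 addr0.
have [f [cf fU mf]] := sx U oU Ux.
exists (fun x => (f x)%:C); split => [|y /fU ->//|]; first exact: ccont_real.
by apply: contra mf => /eqP m0; rewrite /re_meas m0.
Qed.

End ComplexMeasures.

(** * From real functionals back to complex harmonic measures *)

Theorem theorem4p18 (R : realType) (K : topologicalType)
  (conv : K -> K -> meas R K) (inv : K -> K) (e : K)
  (hK : is_compact_hypergroup conv inv e)
  (omega : meas R K) (homega : is_left_haar conv omega)
  (homega1 : omega (fun _ => 1) = 1)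
  (sigma : meas R K) (hsigma : is_probability sigma)
  (hadapt : adapted conv inv sigma) :
  forall mu : meas R K,
    in_Hsigma conv sigma mu <->
    (is_cmeasure mu /\ exists c : R[i], meq mu (fun f => c * omega f)).
Proof.
case: hK => hausK cptK hprob hcont hassoc hup _ hunit hinvc hinvK hinv hes.
case: homega => comega pomega _ homega.
have homegap : is_probability omega by split.
have [csigma _ sigma1] := hsigma.
have convr x f : ccont f -> ccont (fun y => conv x y f).
  by move=> /hcont[cr ci]; split;
    [exact: (@continuous_pairr _ _ _ _ x cr)|exact: (@continuous_pairr _ _ _ _ x ci)].
move=> mu; split => [[cmu hmu]|[cmu [c muE]]]; split => //; last first.
  (* Left invariance of [omega] makes the inner integral constant in [x], and [sigma] has mass 1. *)
  move=> f cf; rewrite /mconv muE// -[RHS]mulr1 -sigma1 -cmeasure_cst//.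
  congr sigma; apply/funext => x; rewrite muE; last exact: convr.
  by congr (_ * _); exact: homega.
(* Testing on the constant 1, where [omega] is 1, forces this scalar. *)
exists (mu (fun _ => 1)).
pose c x y := re_meas (conv x y).
have cE x y (f : K -> R) : continuous f -> conv x y (fun z => (f z)%:C%C) = (c x y f)%:C%C.
  by move=> cf; exact: probability_real.
have c_cont (f : K -> R) : continuous f -> continuous (fun p : K * K => c p.1 p.2 f).
  by move=> /ccont_real/hcont[].
have c_contr x (f : K -> R) : continuous f -> continuous (fun y => c x y f).
  by move=> /c_cont cf; exact: (@continuous_pairr _ _ _ _ x cf).
have c_contl y (f : K -> R) : continuous f -> continuous (fun x => c x y f).
  by move=> /c_cont cf; exact: (@continuous_pairl _ _ _ _ y cf).
have fsuppE x y : fsupp (c x y) = msupp (conv x y) by rewrite msupp_re.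
have [bre bim] := re_im_meas_bounded cmu.
pose om := re_meas omega; pose sg := re_meas sigma.
have omE (f : K -> R) : continuous f -> omega (fun z => (f z)%:C%C) = (om f)%:C%C.
  by move=> cf; exact: probability_real.
(* A general [nu] is kept here because both the real and the imaginary part of [mu] will be
   inserted. *)
have haarE nu : bounded_functional nu ->
    (forall f, continuous f -> sg (fun x => nu (fun y => c x y f)) = nu f) ->
    forall f, continuous f -> nu f = nu (fun _ => 1) * om f.
  apply: (@harmonic_functional_haar R K hausK cptK c inv e) => //.
  - by move=> x y; exact: probability_re.
  - move=> x y z f cf; have := hassoc x y z _ (ccont_real cf).
    rewrite /mconv /Defs.dirac.
    under eq_fun do rewrite cE//.
    under [in RHS]eq_fun do rewrite cE//.
    by rewrite !cE; [case|exact: c_contl|exact: c_contr].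
  - move=> U oU; have := hup U oU; congr open; apply/funext => p /=.
    by rewrite fsuppE.
  - by move=> x f cf; rewrite /c /re_meas (hunit x).1//; exact: ccont_real.
  - by move=> x f cf; rewrite /c /re_meas (hunit x).2//; exact: ccont_real.
  - by move=> x y f cf; rewrite /c /re_meas -hinv//; exact: ccont_real.
  - by move=> x y; rewrite fsuppE.
  - exact: probability_re.
  - move=> x f cf; have := homega x _ (ccont_real cf); rewrite /mconv /Defs.dirac.
    under eq_fun do rewrite cE//.
    by rewrite !omE; [case|exact: cf|exact: c_contr].
  - exact: probability_re.
  (* Every power lies in [A] by induction on the exponent; [setpow] at 0 is the generating set
     itself, so the base case rests on [A1] and [A2]. *)
  - move=> A cA A1 A2 A3 x; have : [set: K] x by [].
    rewrite -hadapt => clx.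
    have : closure A x.
      apply: closureS clx => z [n]; elim: n z => [|n IH] z /=.
        by rewrite msupp_re// => -[/A1//|[y sy <-]]; exact: A2.
      move=> [a [b [/IH Aa sb]]]; rewrite -fsuppE; apply: A3 => //.
      move: sb; rewrite msupp_re// => -[|[y sy <-]]; first by left.
      by right; rewrite hinvK.
    by rewrite -(closure_id A).1.
have harm (f : K -> R) : continuous f ->
    sg (fun x => re_meas mu (fun y => c x y f)) = re_meas mu f /\
    sg (fun x => im_meas mu (fun y => c x y f)) = im_meas mu f.
  move=> cf; have := hmu _ (ccont_real cf); rewrite /mconv.
  have H x : mu (fun y => conv x y (fun z => (f z)%:C%C)) = mu (fun y => (c x y f)%:C%C).
    by congr mu; apply/funext => y; rewrite cE.
  under eq_fun do rewrite H.
  have cr : continuous (fun x => re_meas mu (fun y => c x y f)).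
    by have := continuous_param cptK bre (c_cont f cf).
  have ci : continuous (fun x => im_meas mu (fun y => c x y f)).
    by have := continuous_param cptK bim (c_cont f cf).
  (* [sigma] is real on real functions, so the complex equation splits into its two coordinates. *)
  rewrite meas_ReIm//= probability_real// probability_real// => E.
  by rewrite /re_meas /im_meas -E /=; split; ring.
have mu_real (f : K -> R) : continuous f ->
    mu (fun x => (f x)%:C%C) = mu (fun _ => 1) * omega (fun x => (f x)%:C%C).
  move=> cf; rewrite omE// [LHS]complexE -/(re_meas mu f) -/(im_meas mu f).
  rewrite (haarE _ bre) => [|g /harm[]//|//]; rewrite (haarE _ bim) => [|g /harm[]//|//].
  by rewrite [mu (fun _ => 1)]complexE !rmorphM /= mulrDl mulrA.
move=> f cf; rewrite (meas_ReIm cmu cf) (meas_ReIm comega cf); have [cr ci] := cf.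
by rewrite (mu_real _ ci) (mu_real _ cr) mulrDr mulrCA.
Qed.
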